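(* In the edge-distinguishing game (EDGe) played on the cycle $C_6$ (with $\lambda(C_6)$ colors), Player 1 has a winning strategy.
   Context: $C_n$ is the cycle on $n$ vertices. For a positive integer $k$ let $[k]=\{1,\dots,k\}$. A $k$-coloring $c:V(G)\to[k]$ induces $c'(\{u,v\})=\{c(u),c(v)\}$ (a multiset); $c$ is edge-distinguishing if $c'$ is injective, and $\lambda(G)$ is the least $k$ admitting such a coloring. A partial coloring on $U\subseteq V(G)$ has partial induced edge coloring on $G[U]$. EDGe on $G$: two players, Player 1 first, alternately color an uncolored vertex with a color from $[\lambda(G)]$; a move is legal iff afterwards the partial induced edge coloring of the colored vertices is injective. The player making the last legal move wins. A winning strategy guarantees a win regardless of the opponent's play. *)

(* Defs.v *)
From mathcomp Require Import all_boot.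
From mathcomp Require Import finmap multiset.

Set Implicit Arguments.
Unset Strict Implicit.
Unset Printing Implicit Defensive.

Record sgraph := SGraph {
  vertex :> finType;
  adj : rel vertex;
  adj_sym : symmetric adj;
  adj_irrefl : irreflexive adj }.

Definition edges (G : sgraph) : {set {set G}} :=
  [set E : {set G} | [exists u, exists v, adj u v && (E == [set u; v])]].

(* Edges of the induced subgraph G[U]. *)
Definition edges_in (G : sgraph) (U : {set G}) : {set {set G}} :=
  [set E in edges G | E \subset U].

Definition cycle_adj (n : nat) : rel 'I_n :=
  fun i j => (i != j) && ((j == ordS i) || (i == ordS j)).

Lemma cycle_adj_sym n : symmetric (@cycle_adj n).
Proof. by move=> i j; rewrite /cycle_adj eq_sym orbC. Qed.

Lemma cycle_adj_irrefl n : irreflexive (@cycle_adj n).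
Proof. by move=> i; rewrite /cycle_adj eqxx. Qed.

(* The cycle C_n; the guard [i != j] in [cycle_adj] matters only for n = 1, so
   that the graph is loopless for every n.  For n >= 3 this is the usual C_n. *)
Definition cycle_graph (n : nat) : sgraph :=
  SGraph (@cycle_adj_sym n) (@cycle_adj_irrefl n).

(* The color set [k] is 'I_k.  For E = {u, v}, [induced c E] is the multiset
   {c u, c v}. *)
Definition induced (G : sgraph) (k : nat) (c : G -> 'I_k) (E : {set G}) :
  {mset 'I_k}%mset := seq_mset [seq c x | x <- enum E].

Definition edge_distinguishing (G : sgraph) (k : nat) (c : G -> 'I_k) : bool :=
  dinjectiveb (induced c) (mem (edges G)).

Definition ed_colorable (G : sgraph) (k : nat) : bool :=
  (0 < k) && [exists c : {ffun G -> 'I_k}, edge_distinguishing c].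

Lemma ed_colorable_ex (G : sgraph) : exists k, ed_colorable G k.
Proof.
exists #|G|.+1; rewrite /ed_colorable /=; apply/existsP.
pose r (x : G) : 'I_#|G|.+1 := widen_ord (leqnSn _) (enum_rank x).
have r_inj : injective r.
  by move=> x y /(congr1 val) /= /val_inj /enum_rank_inj.
exists [ffun x => r x]; apply/dinjectiveP => E F _ _ /eq_seq_msetP /perm_mem eEF.
apply/setP=> x; have := eEF (r x).
have fE (A : {set G}) :
    (r x \in [seq [ffun x0 => r x0] x0 | x0 <- enum A]) = (x \in A).
  rewrite -(mem_enum A) -(mem_map r_inj); congr (_ \in _).
  by apply: eq_map => y; rewrite ffunE.
by rewrite !fE.
Qed.

(* lambda(G) *)
Definition ed_number (G : sgraph) : nat := ex_minn (ed_colorable_ex G).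

(* A partial k-coloring; its domain is the set of vertices not sent to None. *)
Definition pcoloring (G : sgraph) (k : nat) := {ffun G -> option 'I_k}.

Definition colored (G : sgraph) (k : nat) (c : pcoloring G k) : {set G} :=
  [set v | c v != None].

(* For an edge E = {u, v} of G[colored c], [pinduced c E] is the multiset of the
   colors of u and v; its value on other edges is never used. *)
Definition pinduced (G : sgraph) (k : nat) (c : pcoloring G k) (E : {set G}) :
  {mset 'I_k}%mset := seq_mset (pmap c (enum E)).

Definition pedge_distinguishing (G : sgraph) (k : nat) (c : pcoloring G k) :
  bool := dinjectiveb (pinduced c) (mem (edges_in (colored c))).

(* A move (v, a) colors the vertex v with the color a of [lambda(G)]. *)
Definition move (G : sgraph) : Type := (G * 'I_(ed_number G))%type.

Definition play_move (G : sgraph) (c : pcoloring G (ed_number G)) (m : move G) :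
  pcoloring G (ed_number G) := [ffun v => if v == m.1 then Some m.2 else c v].

Definition legal (G : sgraph) (c : pcoloring G (ed_number G)) (m : move G) :
  bool := (m.1 \notin colored c) && pedge_distinguishing (play_move c m).

(* A history is the list of the moves made so far, in chronological order. *)
Definition position (G : sgraph) (h : seq (move G)) :
  pcoloring G (ed_number G) := foldl (@play_move G) [ffun=> None] h.

Variant player := Player1 | Player2.

Definition to_move (G : sgraph) (h : seq (move G)) : player :=
  if odd (size h) then Player2 else Player1.

Definition last_mover (G : sgraph) (h : seq (move G)) : player :=
  if odd (size h) then Player1 else Player2.

Definition finished (G : sgraph) (h : seq (move G)) : Prop :=
  forall m : move G, ~~ legal (position h) m.

Definition strategy (G : sgraph) : Type := seq (move G) -> option (move G).

(* Histories of legal play in which player i obeys s and the opponent is free. *)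
Inductive consistent (G : sgraph) (i : player) (s : strategy G) :
  seq (move G) -> Prop :=
| consistent_nil : consistent i s [::]
| consistent_rcons h m : consistent i s h -> legal (position h) m ->
    (to_move h = i -> s h = Some m) -> consistent i s (rcons h m).

(* The first clause says that s never leaves player i without a prescribed legal
   move while one exists, so that play only stops at a finished history. *)
Definition winning_strategy (G : sgraph) (i : player) (s : strategy G) : Prop :=
  (forall h, consistent i s h -> to_move h = i -> ~ finished h ->
     exists2 m, s h = Some m & legal (position h) m) /\
  (forall h, consistent i s h -> finished h -> last_mover h = i).

Definition has_winning_strategy (G : sgraph) (i : player) : Prop :=
  exists s : strategy G, winning_strategy i s.

(* Main.v *)
(** Writing the colors around the cycle, an edge-distinguishing k-coloring of
    C_6 gives six distinct ordered pairs of consecutive colors, so k^2 >= 6 and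
    k >= 3; the coloring 0,0,1,1,2,2 shows that three colors suffice.  On the
    resulting finite game, a search by computation over boards (sequences of
    optional colors) finds that Player 1 always has a move after which every
    legal reply is again won within three rounds, a round being a move of
    Player 1 followed by a reply of Player 2. *)

From mathcomp Require Import all_boot zify.
From mathcomp Require Import finmap multiset.
Require Import Defs.

Set Implicit Arguments.
Unset Strict Implicit.
Unset Printing Implicit Defensive.

(** * A computable model of the game and its search *)

(** The multiset of the two end colors is encoded by its sorted pair, so that comparing multisets
    reduces by computation; [None] marks an edge with an uncolored end. *)
Definition board_edge (n : nat) (s : seq (option nat)) (i : nat) :=
  if nth None s i is Some a then
    if nth None s (i.+1 %% n) is Some b then Some (minn a b, maxn a b) else None
  else None.

Definition board_ok (n : nat) (s : seq (option nat)) : bool :=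
  all (fun i => if board_edge n s i is Some p then
         all (fun j => if board_edge n s j == Some p then i == j else true)
             (iota 0 n)
       else true) (iota 0 n).

Definition board_legal (n : nat) (s : seq (option nat)) (i a : nat) : bool :=
  if nth None s i is None then board_ok n (set_nth None s i (Some a))
  else false.

(* The player to move makes the last move during one of the next [r] rounds.
   Running out of rounds counts as a loss, so no separate argument that the game
   terminates is needed. *)
Fixpoint board_forces (n k r : nat) (s : seq (option nat)) : bool :=
  if r is r'.+1 then
    has (fun i => has (fun a =>
      if board_legal n s i a then
        let s1 := set_nth None s i (Some a) in
        all (fun j => all (fun b =>
          if board_legal n s1 j b then
            board_forces n k r' (set_nth None s1 j (Some b))
          else true) (iota 0 k)) (iota 0 n)
      else false) (iota 0 k)) (iota 0 n)
  else false.

Lemma board_forces6 : board_forces 6 3 3 (nseq 6 None).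
(* Lazy evaluation lets each [has] stop at the first success. *)
Proof. by lazy. Qed.

Lemma board_forcesSP n k r s :
  reflect (exists i a, [/\ i < n, a < k, board_legal n s i a &
             forall j b, j < n -> b < k ->
               board_legal n (set_nth None s i (Some a)) j b ->
               board_forces n k r
                 (set_nth None (set_nth None s i (Some a)) j (Some b))])
          (board_forces n k r.+1 s).
Proof.
apply: (iffP hasP) => [[i + /hasP [a]]|[i [a [lin lak Lia H]]]].
  rewrite !mem_iota /= !add0n => lin lak; case: ifP => // Lia /allP H.
  exists i, a; split=> // j b ljn lbk Ljb.
  have /H /allP /(_ b) : j \in iota 0 n by rewrite mem_iota.
  by rewrite mem_iota Ljb; apply.
exists i; first by rewrite mem_iota.
apply/hasP; exists a; first by rewrite mem_iota.
rewrite Lia; apply/allP=> j; rewrite mem_iota /= => ljn.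
apply/allP=> b; rewrite mem_iota /= => lbk.
by case: ifP => // /H; apply.
Qed.

(** Monotonicity in the number of rounds lets one fixed bound serve as an invariant of the whole
    play. *)
Lemma board_forcesS n k r s : board_forces n k r s -> board_forces n k r.+1 s.
Proof.
elim: r s => // r IHr s /board_forcesSP [i [a [lin lak Lia H]]].
apply/board_forcesSP; exists i, a; split=> // j b ljn lbk Ljb.
exact/IHr/H.
Qed.

(** * Partial colorings of a cycle read as boards *)

Section Board.
Variables n k : nat.
Hypothesis n_gt2 : 2 < n.
Implicit Types (c : pcoloring (cycle_graph n) k) (i j : 'I_n).

Definition board c : seq (option nat) :=
  [seq omap (@nat_of_ord k) (c i) | i <- enum 'I_n].

Lemma size_board c : size (board c) = n.
Proof. by rewrite size_map size_enum_ord. Qed.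

Lemma nth_board c i : nth None (board c) i = omap (@nat_of_ord k) (c i).
Proof. by rewrite (nth_map i) ?size_enum_ord // nth_ord_enum. Qed.

Lemma neq_ordS i : i != ordS i.
Proof.
apply/eqP=> /(congr1 (@nat_of_ord n)) /=; have := ltn_ord i.
have [lt_i|ge_i] := ltnP i.+1 n; first by rewrite modn_small //; lia.
have -> : i.+1 = n by have := ltn_ord i; lia.
by rewrite modnn; lia.
Qed.

Lemma ordS2_neq i : ordS (ordS i) != i.
Proof.
apply/eqP=> /(congr1 (@nat_of_ord n)) /=; have := ltn_ord i.
rewrite -(addn1 (i.+1 %% n)) modnDml addn1.
(* Wrapping around leaves [i = n - 2], sent to 0, and [i = n - 1], sent to 1; both differ from [i]
   because [n > 2]. *)
have [lt_i|ge_i] := ltnP i.+2 n; first by rewrite modn_small //; lia.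
have [Ei|Ei] : i.+2 = n \/ i.+2 = 1 + n by have := ltn_ord i; lia.
  by rewrite Ei modnn; lia.
by rewrite Ei modnDr modn_small; lia.
Qed.

(** Two distinct indices of the same edge would be successors of each other, against [ordS2_neq]. *)
Lemma cycle_edge_inj : injective (fun i => [set i; ordS i]).
Proof.
move=> i j /setP eE.
have := eE i; rewrite !inE eqxx /= => /esym /orP[/eqP //|/eqP ij].
have := eE j; rewrite !inE eqxx /= => /orP[/eqP //|/eqP ji].
by have := ordS2_neq j; rewrite -ij -ji eqxx.
Qed.

Lemma cycle_edgesP (E : {set cycle_graph n}) :
  reflect (exists i, E = [set i; ordS i]) (E \in edges (cycle_graph n)).
Proof.
rewrite inE; apply: (iffP existsP) => [[u /existsP[v]]|[i ->]].
  case/andP=> /andP[_ /orP[/eqP->|/eqP->]] /eqP->; first by exists u.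
  by exists v; rewrite setUC.
exists i; apply/existsP; exists (ordS i).
by rewrite eqxx andbT /= /cycle_adj neq_ordS eqxx.
Qed.

Lemma perm_enum_cycle_edge i : perm_eq (enum [set i; ordS i]) [:: i; ordS i].
Proof.
apply: uniq_perm; first exact: enum_uniq.
  by rewrite /= inE neq_ordS.
by move=> x; rewrite mem_enum !inE.
Qed.

Lemma perm_eq2_minmax (a b a' b' : 'I_k) :
  perm_eq [:: a; b] [:: a'; b'] =
  ((minn a b, maxn a b) == (minn a' b', maxn a' b')).
Proof.
apply/idP/eqP => [/permP P|[]].
  (* Counting the occurrences of [a] and of [b] on both sides is enough for arithmetic to
     conclude. *)
  have := P (pred1 a); have := P (pred1 b).
  by rewrite /= -!val_eqE /= => Pb Pa; congr pair; lia.
move=> emin emax.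
have [[/val_inj -> /val_inj -> //]|[/val_inj -> /val_inj ->]] :
    (a = a' :> nat /\ b = b' :> nat) \/ (a = b' :> nat /\ b = a' :> nat) by lia.
by rewrite (perm_catC [:: b'] [:: a']).
Qed.

Lemma board_edge_Some c i p : board_edge n (board c) i = Some p ->
  exists a b, [/\ c i = Some a, c (ordS i) = Some b &
                  p = (minn a b, maxn a b)].
Proof.
rewrite /board_edge nth_board (nth_board c (ordS i)).
case: (c i) => [a|] //=; case: (c (ordS i)) => [b|] //= [<-].
by exists a, b.
Qed.

Lemma cycle_edge_colored c i :
  ([set i; ordS i] \in edges_in (colored c)) =
  (board_edge n (board c) i != None).
Proof.
rewrite inE; have -> /= : [set i; ordS i] \in edges (cycle_graph n).
  by apply/cycle_edgesP; exists i.
rewrite subUset !sub1set !inE /board_edge nth_board (nth_board c (ordS i)).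
by case: (c i) (c (ordS i)) => [a|] [b|].
Qed.

Lemma pinduced_cycle_edge c i j p q :
  board_edge n (board c) i = Some p -> board_edge n (board c) j = Some q ->
  (pinduced c [set i; ordS i] == pinduced c [set j; ordS j]) = (p == q).
Proof.
move=> /board_edge_Some[a [b [ci cSi ->]]] /board_edge_Some[a' [b' [cj cSj ->]]].
rewrite -perm_eq2_minmax.
(* The order in which [enum] lists the two ends is irrelevant to the multiset. *)
have P l : perm_eq (pmap c (enum [set l; ordS l])) (pmap c [:: l; ordS l]).
  exact/perm_pmap/perm_enum_cycle_edge.
have -> : [:: a; b] = pmap c [:: i; ordS i] by rewrite /= ci /= cSi.
have -> : [:: a'; b'] = pmap c [:: j; ordS j] by rewrite /= cj /= cSj.
by rewrite -(permPl (P i)) -(permPr (P j)); apply/eqP/idP => /eq_seq_msetP.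
Qed.

Lemma board_okP s :
  reflect (forall i j, board_edge n s i != None ->
             board_edge n s i = board_edge n s j -> i = j)
          (board_ok n s).
Proof.
apply: (iffP allP) => [H i j Ei Eij|H i].
  have /H : (i : nat) \in iota 0 n by rewrite mem_iota /=.
  case Ep: (board_edge n s i) Ei => [p|] // _ /allP /(_ j).
  by rewrite mem_iota /= ltn_ord -Eij Ep eqxx => /(_ isT) /eqP /val_inj.
rewrite mem_iota /= => lt_in; case Ei: board_edge => [p|] //.
apply/allP=> j; rewrite mem_iota /= => lt_jn; case: eqP => // Ej.
have /(congr1 val) /= -> // : Ordinal lt_in = Ordinal lt_jn.
by apply: H; rewrite /= Ei ?Ej.
Qed.

Lemma pedge_distinguishingE c : pedge_distinguishing c = board_ok n (board c).
Proof.
apply/dinjectiveP/board_okP => [inj i j Ei Eij|H E F].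
  apply: cycle_edge_inj; apply: inj; rewrite ?cycle_edge_colored -?Eij //.
  move: Ei Eij; case Ei: (board_edge _ _ i) => [p|] // _ /esym Ej.
  by apply/eqP; rewrite (pinduced_cycle_edge Ei Ej).
move=> eE eF; have /cycle_edgesP[i EE] : E \in edges (cycle_graph n).
  by move: eE; rewrite inE => /andP[].
have /cycle_edgesP[j EF] : F \in edges (cycle_graph n).
  by move: eF; rewrite inE => /andP[].
move: eE eF; rewrite {}EE {}EF !cycle_edge_colored => Ei Ej eP.
rewrite (H i j Ei) //; move: Ei Ej eP.
case Ei: (board_edge _ _ i) => [p|] // _.
case Ej: (board_edge _ _ j) => [q|] // _ /eqP.
by rewrite (pinduced_cycle_edge Ei Ej) => /eqP ->.
Qed.

End Board.

(** * The value of lambda for the 6-cycle *)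

(** Seen as a partial coloring with full domain, a coloring is subject to the same board test as a
    position. *)
Lemma edge_distinguishingE (G : sgraph) k (c : G -> 'I_k) :
  edge_distinguishing c =
  pedge_distinguishing [ffun x => Some (c x)].
Proof.
have iE E : induced c E = pinduced [ffun x => Some (c x)] E.
  rewrite /induced /pinduced; congr seq_mset.
  by elim: (enum E) => //= x s ->; rewrite ffunE.
have eE : edges_in (colored [ffun x => Some (c x)]) = edges G.
  apply/setP=> E; rewrite inE; case: (E \in _) => //=.
  by apply/subsetP=> x _; rewrite inE ffunE.
rewrite /pedge_distinguishing eE.
by apply/dinjectiveP/dinjectiveP=> inj E F eE' eF; [rewrite -!iE|rewrite !iE];
  apply: inj.
Qed.

Lemma ed_number_C6 : ed_number (cycle_graph 6) = 3.
Proof.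
rewrite /ed_number; case: ex_minnP => k /andP[_ /existsP[c]].
rewrite edge_distinguishingE pedge_distinguishingE // => /board_okP okc min_k.
apply/eqP; rewrite eqn_leq; apply/andP; split.
  apply: min_k; apply/andP; split=> //; apply/existsP.
  exists [ffun i : 'I_6 => inord (i %/ 2)].
  rewrite edge_distinguishingE pedge_distinguishingE //.
  rewrite (_ : board _ = [:: Some 0; Some 0; Some 1; Some 1; Some 2; Some 2]) //.
  apply: (@eq_from_nth _ None) => [|i]; rewrite size_board // => lt_i6.
  rewrite (nth_board _ (Ordinal lt_i6)) !ffunE /=.
  by case: i lt_i6 => [|[|[|[|[|[|]]]]]] //= _; rewrite inordK.
suff : 6 <= k * k by case: k {c okc min_k} => [|[|[|]]].
(* Equal ordered pairs give equal sorted pairs, hence equal edges. *)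
have f_inj : injective (fun i : 'I_6 => (c i, c (ordS i))).
  move=> i j [cij cSij]; apply: okc.
    by rewrite /board_edge nth_board (nth_board _ (ordS i)) !ffunE.
  rewrite /board_edge !nth_board (nth_board _ (ordS i)) (nth_board _ (ordS j)).
  by rewrite !ffunE /= cij cSij.
by have := leq_card _ f_inj; rewrite card_prod !card_ord.
Qed.

(** * Moves as updates of boards *)

Section Play.
Variable n : nat.
Hypothesis n_gt2 : 2 < n.
Implicit Type c : pcoloring (cycle_graph n) (ed_number (cycle_graph n)).

Lemma board_play_move c m :
  board (play_move c m) =
  set_nth None (board c) (m.1 : 'I_n) (Some (m.2 : nat)).
Proof.
apply: (@eq_from_nth _ None) => [|i].
  by rewrite size_set_nth !size_board; apply/esym/maxn_idPr/ltn_ord.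
rewrite size_board => lt_in; rewrite nth_set_nth /=.
rewrite (nth_board _ (Ordinal lt_in)) (nth_board c (Ordinal lt_in)) ffunE.
by rewrite -(inj_eq val_inj) /=; case: eqP.
Qed.

Lemma legal_board c m :
  legal c m = board_legal n (board c) (m.1 : 'I_n) (m.2 : nat).
Proof.
rewrite /legal pedge_distinguishingE // board_play_move /board_legal nth_board.
by rewrite inE negbK; case: (c m.1).
Qed.

End Play.

(** * From an invariant to a winning strategy *)

(* Player 1 keeps the position in [S] at each of his turns; he is thus never
   stuck, so whenever the game is over it is Player 2's turn. *)
Lemma Player1_wins_from (G : sgraph) (S : pred (pcoloring G (ed_number G))) :
  S [ffun=> None] ->
  (forall c, S c -> exists2 m, legal c m &
     forall m', legal (play_move c m) m' -> S (play_move (play_move c m) m')) ->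
  has_winning_strategy G Player1.
Proof.
move=> S0 step.
(* A boolean condition on a finite type of moves, so that [pick] can select a move. *)
pose good c (m : move G) := legal c m &&
  [forall m' : G * 'I_(ed_number G), legal (play_move c m) m' ==>
     S (play_move (play_move c m) m')].
have posr h m : position (rcons h m) = play_move (position h) m.
  by rewrite /position -cats1 foldl_cat.
pose s (h : seq (move G)) : option (move G) :=
  [pick m : G * 'I_(ed_number G) | good (position h) m].
have sP h : S (position h) -> exists2 m, s h = Some m & good (position h) m.
  rewrite /s => /step[m Lm Hm]; case: pickP => [m' ?|/(_ m)]; first by exists m'.
  rewrite /good Lm /=; case/negP; apply/forallP=> m'.
  exact/implyP/Hm.
(* On Player 2's turns the invariant looks one move ahead: every legal reply leads back into [S]. *)
have inv h : consistent Player1 s h ->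
    if odd (size h) then
      forall m', legal (position h) m' -> S (play_move (position h) m')
    else S (position h).
  elim=> [//|{}h m _ IH Lm sm]; rewrite size_rcons /= posr.
  move: IH sm; rewrite /to_move; case: (odd _) => [IH _|Sh sm] /=; first exact: IH.
  have [m' sm' /andP[_ /forallP Hm]] := sP _ Sh.
  move: (sm erefl); rewrite sm' => -[em]; rewrite -em => m''.
  exact/implyP/Hm.
exists s; split=> h ch.
  rewrite /to_move; have := inv h ch; case: (odd _) => // Sh _ _.
  by have [m sm /andP[Lm _]] := sP _ Sh; exists m.
move=> fin; rewrite /last_mover; have := inv h ch; case: (odd _) => // Sh.
by have [m _ /andP[Lm _]] := sP _ Sh; have := fin m; rewrite Lm.
Qed.

Theorem theorem3p15 : has_winning_strategy (cycle_graph 6) Player1.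
Proof.
apply: (Player1_wins_from (S := fun c => board_forces 6 3 3 (board c))).
  rewrite (_ : board _ = nseq 6 None) ?board_forces6 //.
  apply: (@eq_from_nth _ None) => [|i]; rewrite size_board // => lt_i6.
  by rewrite (nth_board _ (Ordinal lt_i6)) ffunE nth_nseq lt_i6.
move=> c /board_forcesSP[i [a [lt_i lt_a Lia H]]].
(* The colors of the game are bounded by [ed_number], those of the search by 3. *)
rewrite -ed_number_C6 in lt_a.
exists (Ordinal lt_i, Ordinal lt_a); first by rewrite legal_board.
move=> [j b]; rewrite legal_board // !board_play_move => Ljb.
(* After the round two rounds suffice; the bound is raised back to three to restore [S]. *)
apply: board_forcesS; apply: H => //.
by rewrite -[X in _ < X]ed_number_C6.
Qed.
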